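(* Let $p$ be a prime and let $f:\mathbb{Z}_p\times\mathbb{Z}_p\to\mathbb{Z}_p$ be additively inseparable with $\Delta(f)=2$. Let $P$ be a no-signalling box with inputs and outputs in $\mathbb{Z}_p$ that satisfies information causality, and define $$\nu_j=\frac1{p^2}\sum_{x,y=0}^{p-1}\sum_{k=0}^{p-1}P(a=k,\,b=k-f(x,y)+j\mid x,y)\quad\text{for } j\in\mathbb{Z}_p.$$ Then: (i) for every integer $1\le N\le p$ and every $c\in\mathbb{Z}_p$, $$\frac1p\sum_{k=0}^{p-1}\omega_p^{ck}\Big(\sum_{j=0}^{p-1}\nu_j\omega_p^{jk}\Big)^{N-1}\le T_p^{-1}\Big(\frac{N-1}{N}\log_2p\Big);$$ (ii) for every $n\ge1$, with $N=p^n$, and every $c\in\mathbb{Z}_p$, $$\frac1p\sum_{k=0}^{p-1}\omega_p^{ck}\Big(\sum_{j=0}^{p-1}\nu_j\omega_p^{jk}\Big)^{n(p-1)}\le T_p^{-1}\Big(\frac{N-1}{N}\log_2p\Big).$$ Here $\omega_p=e^{2\pi i/p}$.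
   Context: Let $p$ be a prime. All arithmetic on elements of $\mathbb{Z}_p$ is modulo $p$. A box is a conditional probability distribution $P(a,b\mid x,y)$ with $a,b,x,y\in\mathbb{Z}_p$. It is shared by Alice, who supplies $x$ and receives $a$, and Bob, who supplies $y$ and receives $b$. Different copies act independently. $P$ is no-signalling if $\sum_bP(a,b\mid x,y)$ does not depend on $y$ and $\sum_aP(a,b\mid x,y)$ does not depend on $x$. A function $f$ is additively separable if $f(x,y)=g(x)+h(y)$ for some $g,h:\mathbb{Z}_p\to\mathbb{Z}_p$. Otherwise it is additively inseparable. Every $f$ can be written uniquely as $f(x,y)=\sum_{i,j=0}^{p-1}\lambda_{i,j}x^iy^j$. Define $\Delta(f)=\max_{1\le i,j\le p-1}\mathbb{I}_{\lambda_{i,j}\ne0}(i+j)$. Thus $\Delta(f)=2$ means $f(x,y)=\lambda xy+g(x)+h(y)$ with $\lambda\ne0$. $P$ satisfies information causality if, for every $N\ge1$, every protocol of the following form satisfies $\sum_{i=0}^{N-1}I(x_i:b\mid y=i)\le\log_2p$. In the protocol: - Alice receives $\vec x=(x_0,\dots,x_{N-1})$ uniform in $\mathbb{Z}_p^N$, and Bob receives $y$ uniform in $\{0,\dots,N-1\}$, independent of $\vec x$. - They share randomness (independent of the inputs) and finitely many copies of $P$. - Alice's inputs to her ends of the boxes are functions of $\vec x$, the shared randomness, and her previously obtained outputs. - Alice sends a single message $q\in\mathbb{Z}_p$ to Bob, which is a function of $\vec x$, the randomness, and her outputs. - Bob's inputs to his ends of the boxes are functions of $y$, $q$, the shared randomness,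 and his previously obtained outputs. - Bob finally outputs $b\in\mathbb{Z}_p$. Here $I(x_i:b\mid y=i)$ is the Shannon mutual information (in bits) between $x_i$ and $b$ under the distribution conditioned on $y=i$. Let $h(x)=-x\log_2x-(1-x)\log_2(1-x)$ and $T_p(x)=h(x)+(1-x)\log_2(p-1)$. On $[1/p,1]$, $T_p$ decreases strictly from $\log_2p$ to $0$. $T_p^{-1}:[0,\log_2p]\to[1/p,1]$ denotes the inverse of this restriction. *)

(* Defs.v *)
From HB Require Import structures.
From mathcomp Require Import all_boot all_algebra.
From Stdlib Require Import Reals ClassicalEpsilon.
Set Implicit Arguments. Unset Strict Implicit. Unset Printing Implicit Defensive.
Open Scope R_scope.

Definition Rsum (T : finType) (F : T -> R) : R := \big[Rplus/R0]_(t : T) F t.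

Definition Cplx := (R * R)%type.
Definition Cadd (z w : Cplx) : Cplx := (fst z + fst w, snd z + snd w).
Definition Cmul (z w : Cplx) : Cplx :=
  (fst z * fst w - snd z * snd w, fst z * snd w + snd z * fst w).
Definition Cscal (a : R) (z : Cplx) : Cplx := (a * fst z, a * snd z).
Fixpoint Cpow (z : Cplx) (n : nat) : Cplx :=
  match n with O => (R1, R0) | S m => Cmul z (Cpow z m) end.
Definition Csum (T : finType) (F : T -> Cplx) : Cplx :=
  (Rsum (fun t => fst (F t)), Rsum (fun t => snd (F t))).
Definition Re (z : Cplx) : R := fst z.
Definition omega (p : nat) : Cplx := (cos (2 * PI / INR p), sin (2 * PI / INR p)).

Definition log2 (x : R) : R := ln x / ln 2.
Definition xlog2 (x : R) : R := if Req_EM_T x 0 then 0 else x * log2 x.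
Definition hbin (x : R) : R := - xlog2 x - xlog2 (1 - x).
Definition Tp (p : nat) (x : R) : R := hbin x + (1 - x) * log2 (INR p - 1).
Definition Tinv (p : nat) (y : R) : R :=
  epsilon (inhabits 0) (fun t => / INR p <= t <= 1 /\ Tp p t = y).

Definition mutual_info (U V : finType) (J : U -> V -> R) : R :=
  Rsum (fun u => Rsum (fun v =>
    let j := J u v in
    let pu := Rsum (fun v' => J u v') in
    let pv := Rsum (fun u' => J u' v) in
    if Req_EM_T j 0 then 0 else j * log2 (j / (pu * pv)))).

(* P a b x y = P(a, b | x, y) *)
Definition box (p : nat) := 'Z_p -> 'Z_p -> 'Z_p -> 'Z_p -> R.

Definition is_box p (P : box p) : Prop :=
  (forall a b x y, 0 <= P a b x y) /\
  (forall x y, Rsum (fun a => Rsum (fun b => P a b x y)) = 1).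

Definition no_signalling p (P : box p) : Prop :=
  (forall a x y y', Rsum (fun b => P a b x y) = Rsum (fun b => P a b x y')) /\
  (forall b x x' y, Rsum (fun a => P a b x y) = Rsum (fun a => P a b x' y)).

(* the input of the i-th box use may depend only on outputs of boxes j < i *)
Definition causal p M (A : Type) (g : 'I_M -> A -> {ffun 'I_M -> 'Z_p} -> 'Z_p) : Prop :=
  forall (i : 'I_M) (s : A) (o o' : {ffun 'I_M -> 'Z_p}),
    (forall j : 'I_M, ltn j i -> o j = o' j) -> g i s o = g i s o'.

(* joint distribution of (x_i, b) conditioned on y = i *)
Definition protocol_joint p N (Rand : finType) M (P : box p) (pi : Rand -> R)
  (alpha : 'I_M -> {ffun 'I_N -> 'Z_p} * Rand -> {ffun 'I_M -> 'Z_p} -> 'Z_p)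
  (msg : {ffun 'I_N -> 'Z_p} * Rand -> {ffun 'I_M -> 'Z_p} -> 'Z_p)
  (beta : 'I_M -> 'I_N * 'Z_p * Rand -> {ffun 'I_M -> 'Z_p} -> 'Z_p)
  (bout : 'I_N * 'Z_p * Rand -> {ffun 'I_M -> 'Z_p} -> 'Z_p)
  (i : 'I_N) : 'Z_p -> 'Z_p -> R :=
  fun u v =>
    Rsum (fun x : {ffun 'I_N -> 'Z_p} =>
      if x i == u then
        Rsum (fun r : Rand => Rsum (fun a : {ffun 'I_M -> 'Z_p} =>
          Rsum (fun b : {ffun 'I_M -> 'Z_p} =>
            let q := msg (x, r) a in
            if bout (i, q, r) b == v then
              / (INR p ^ N) * pi r *
              \big[Rmult/R1]_(k : 'I_M)
                 P (a k) (b k) (alpha k (x, r) a) (beta k (i, q, r) b)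
            else 0)))
      else 0).

Definition info_causality p (P : box p) : Prop :=
  forall (N : nat), ltn O N ->
  forall (Rand : finType) (pi : Rand -> R) (M : nat)
    (alpha : 'I_M -> {ffun 'I_N -> 'Z_p} * Rand -> {ffun 'I_M -> 'Z_p} -> 'Z_p)
    (msg : {ffun 'I_N -> 'Z_p} * Rand -> {ffun 'I_M -> 'Z_p} -> 'Z_p)
    (beta : 'I_M -> 'I_N * 'Z_p * Rand -> {ffun 'I_M -> 'Z_p} -> 'Z_p)
    (bout : 'I_N * 'Z_p * Rand -> {ffun 'I_M -> 'Z_p} -> 'Z_p),
    (forall r, 0 <= pi r) -> Rsum pi = 1 ->
    causal alpha -> causal beta ->
    \big[Rplus/R0]_(i < N) mutual_info (protocol_joint P pi alpha msg beta bout i)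
      <= log2 (INR p).

Definition add_separable p (f : 'Z_p -> 'Z_p -> 'Z_p) : Prop :=
  exists g h : 'Z_p -> 'Z_p, forall x y, f x y = GRing.add (g x) (h y).

Definition poly_rep p (f : 'Z_p -> 'Z_p -> 'Z_p) (lam : 'I_p -> 'I_p -> 'Z_p) : Prop :=
  forall x y, f x y =
    \big[GRing.add/GRing.zero]_(i < p) \big[GRing.add/GRing.zero]_(j < p)
       GRing.mul (lam i j) (GRing.mul (GRing.exp x i) (GRing.exp y j)).

(* Delta(f) = d, where lam is the (unique) coefficient array of f *)
Definition Delta_eq p (f : 'Z_p -> 'Z_p -> 'Z_p) (d : nat) : Prop :=
  exists lam, poly_rep f lam /\
    d = \big[maxn/0%nat]_(ij : 'I_p * 'I_p |
             [&& ltn O ij.1, ltn O ij.2 & lam ij.1 ij.2 != GRing.zero])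
           addn ij.1 ij.2.

Definition nu p (f : 'Z_p -> 'Z_p -> 'Z_p) (P : box p) (j : 'Z_p) : R :=
  / (INR p ^ 2) * Rsum (fun x : 'Z_p => Rsum (fun y : 'Z_p => Rsum (fun k : 'Z_p =>
      P k (GRing.add (GRing.add k (GRing.opp (f x y))) j) x y))).

Definition nu_hat p (f : 'Z_p -> 'Z_p -> 'Z_p) (P : box p) (k : 'Z_p) : Cplx :=
  Csum (fun j : 'Z_p => Cscal (nu f P j) (Cpow (omega p) (muln j k))).

Definition ic_lhs p (f : 'Z_p -> 'Z_p -> 'Z_p) (P : box p) (m : nat) (c : 'Z_p) : Cplx :=
  Cscal (/ INR p) (Csum (fun k : 'Z_p =>
     Cmul (Cpow (omega p) (muln c k)) (Cpow (nu_hat f P k) m))).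

(* Main.v *)
(** Write [f x y = lam x y + g x + h y] with [lam] invertible.  With shared
    uniform masks [r] and [s] on the inputs, one use of [P] lets Alice and Bob
    compute additive shares of [lam u v] up to a noise of law [nu] which is
    independent of [u] and [v].  Taking [lam u = c1 - c0] and [v] in [{0, 1}],
    this merges two messages [c0], [c1] into one from which Bob recovers either
    of them.  Iterating along a complete binary tree of depth [m], Bob recovers
    any one of [N <= 2 ^ m] inputs up to the sum of the [m] noises along his
    path, so the probability that his error is [c] is the left-hand side of the
    theorem with exponent [m].  Information causality then bounds the entropy of
    the error from below by [(N - 1) / N * log2 p], and Fano's inequality with
    the monotonicity of [Tp] converts this into a bound on every probability.
    Both parts follow, as [N <= 2 ^ (N - 1)] and [p ^ n <= 2 ^ (n (p - 1))]. *)

From Stdlib Require Import Reals ClassicalEpsilon Lra.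
Require Import Defs.
From HB Require Import structures.
From mathcomp Require Import all_boot all_algebra zify.
From mathcomp Require ring.
Set Implicit Arguments. Unset Strict Implicit. Unset Printing Implicit Defensive.
Import GRing.Theory.
Open Scope R_scope.

(** * Entropy, Fano's inequality and [Tp] *)

HB.instance Definition _ := Monoid.isComLaw.Build R R0 Rplus
  (fun x y z => esym (Rplus_assoc x y z)) Rplus_comm Rplus_0_l.
HB.instance Definition _ := Monoid.isComLaw.Build R R1 Rmult
  (fun x y z => esym (Rmult_assoc x y z)) Rmult_comm Rmult_1_l.
HB.instance Definition _ := Monoid.isMulLaw.Build R R0 Rmult
  Rmult_0_l Rmult_0_r.
HB.instance Definition _ := Monoid.isAddLaw.Build R Rmult Rplus
  (fun x y z => Rmult_plus_distr_r x y z) Rmult_plus_distr_l.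

Section FiniteSums.
Variable T : finType.
Implicit Types F G : T -> R.

Lemma Rsum_ext F G : F =1 G -> Rsum F = Rsum G.
Proof. by move=> FG; apply: eq_bigr => t _; rewrite FG. Qed.

Lemma Rsum_ge0 F : (forall t, 0 <= F t) -> 0 <= Rsum F.
Proof.
move=> F0; apply: (big_ind (fun x => 0 <= x)) => //; first exact: Rle_refl.
by move=> x y; exact: Rplus_le_le_0_compat.
Qed.

Lemma Rsum_le (A : pred T) F G : (forall t, A t -> F t <= G t) ->
  \big[Rplus/R0]_(t | A t) F t <= \big[Rplus/R0]_(t | A t) G t.
Proof.
move=> FG; apply: (big_ind2 Rle) => //; first exact: Rle_refl.
by move=> *; exact: Rplus_le_compat.
Qed.

Lemma Rsum_const (A : pred T) (x : R) :
  \big[Rplus/R0]_(t | A t) x = INR #|A| * x.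
Proof.
rewrite big_const; elim: #|A| => [|n IHn]; first by rewrite Rmult_0_l.
by rewrite iterS IHn S_INR; ring.
Qed.

Lemma Rsum_cst (x : R) : Rsum (fun _ : T => x) = INR #|T| * x.
Proof. exact: Rsum_const. Qed.

Lemma RsumD F G : Rsum (fun t => F t + G t) = Rsum F + Rsum G.
Proof. exact: big_split. Qed.

Lemma RsumZ x F : Rsum (fun t => x * F t) = x * Rsum F.
Proof. by rewrite /Rsum big_distrr. Qed.

Lemma Rsum_delta F t : Rsum (fun s => if s == t then F s else 0) = F t.
Proof. by rewrite /Rsum -big_mkcond big_pred1_eq. Qed.

End FiniteSums.

Lemma ln2_gt0 : 0 < ln 2.
Proof. have := ln_lt_2; lra. Qed.

Lemma ln_lt_sub1 x : 0 < x -> x <> 1 -> ln x < x - 1.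
Proof.
move=> x0 x1; have lx0 : ln x <> 0.
  by move=> l0; apply: x1; rewrite -(exp_ln x) // l0 exp_0.
by have := exp_ineq1 _ lx0; rewrite exp_ln //; lra.
Qed.

(** This is [ln z < z - 1] at [z = q / m], multiplied by [m]. *)
Lemma gibbs_lt m q : 0 < m -> 0 < q -> m <> q -> m * ln q - m * ln m < q - m.
Proof.
move=> m0 q0 mq; have qm0 : 0 < q / m by apply: Rdiv_lt_0_compat.
have qm1 : q / m <> 1.
  move=> e; apply: mq; rewrite -[LHS]Rmult_1_r -e; field; lra.
have := ln_lt_sub1 qm0 qm1; rewrite /Rdiv ln_mult ?ln_Rinv //; last first.
  exact: Rinv_0_lt_compat.
move=> /(Rmult_lt_compat_l m _ _ m0).
have -> : m * (q * / m - 1) = q - m by field; lra.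
by lra.
Qed.

Lemma gibbs_le m q : 0 <= m -> 0 < q -> m * ln q - m * ln m <= q - m.
Proof.
move=> [m0|<-] q0; last by lra.
case: (Req_dec m q) => [->|mq]; first by lra.
by left; exact: gibbs_lt.
Qed.

Lemma xlog2E x : xlog2 x = x * ln x / ln 2.
Proof.
by rewrite /xlog2 /log2; case: Req_EM_T => /= [x0|_]; rewrite /Rdiv; [rewrite x0|]; ring.
Qed.

Lemma TpE p x :
  Tp p x = (- (x * ln x) - (1 - x) * ln (1 - x) + (1 - x) * ln (INR p - 1)) / ln 2.
Proof. by rewrite /Tp /hbin !xlog2E /log2; field; have := ln2_gt0; lra. Qed.

Lemma INR_ge2 (p : nat) : (1 < p)%N -> 2 <= INR p.
Proof. by move=> p1; have -> : 2 = INR 2 by []; apply: le_INR; lia. Qed.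

(* Gibbs' inequality compares [Tp s] with the cross entropy of the
   distributions of parameters [s] and [t], which is affine in [s] and has
   nonpositive slope as soon as [1 / p <= t]. *)
Lemma Tp_decreasing p s t : (1 < p)%N -> / INR p <= t -> t < s -> s <= 1 ->
  Tp p s < Tp p t.
Proof.
move=> /INR_ge2 p2 pt ts s1; have ip0 : 0 < / INR p by apply: Rinv_0_lt_compat; lra.
rewrite !TpE; apply: Rmult_lt_compat_r; first exact/Rinv_0_lt_compat/ln2_gt0.
have s0 : 0 < s by lra.
have t0 : 0 < t by lra.
have st : s <> t by lra.
have := gibbs_lt s0 t0 st.
(* Only the weak inequality is available for the complements, since [s = 1] is allowed. *)
have s1' : 0 <= 1 - s by lra.
have t1' : 0 < 1 - t by lra.
have := gibbs_le s1' t1'.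
have : ln (1 - t) <= ln (t * (INR p - 1)).
  have : 1 - t <= t * (INR p - 1).
    suff : 1 <= t * INR p by lra.
    by rewrite -(Rinv_l (INR p)); [apply: Rmult_le_compat_r; lra | lra].
  by case=> [h|<-]; [left; apply: ln_increasing | right].
rewrite ln_mult; [move=> slope | lra | lra].
have : (s - t) * ln (1 - t) <= (s - t) * (ln t + ln (INR p - 1)).
  by apply: Rmult_le_compat_l => //; lra.
by lra.
Qed.

(** Gibbs' inequality bounds [- (sqrt x * ln (sqrt x))] by [1], and [x * ln x] is [2 * sqrt x] times
    [sqrt x * ln (sqrt x)]. This serves as a modulus of continuity at [0]. *)
Lemma xlnx_bound x : 0 < x -> x < 1 -> Rabs (x * ln x) <= 2 * sqrt x.
Proof.
move=> x0 x1; have r0 := sqrt_lt_R0 _ x0.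
have rr : sqrt x * sqrt x = x by apply: sqrt_sqrt; lra.
have lx : ln x = 2 * ln (sqrt x) by rewrite -{1}rr ln_mult //; ring.
have lx0 : ln x < 0 by rewrite -ln_1; apply: ln_increasing.
rewrite Rabs_left; last first.
  by have := Rmult_lt_0_compat _ _ x0 (Ropp_0_gt_lt_contravar _ lx0); lra.
have := gibbs_le (Rlt_le _ _ r0) Rlt_0_1; rewrite ln_1 => g.
have : sqrt x * - (sqrt x * ln (sqrt x)) <= sqrt x * (1 - sqrt x).
  by apply: Rmult_le_compat_l; lra.
rewrite -Ropp_mult_distr_r -Rmult_assoc rr lx => h.
have : sqrt x * (1 - sqrt x) <= sqrt x by rewrite Rmult_minus_distr_l rr; lra.
by lra.
Qed.

(** [ln] is [0] on nonpositive reals, so [x * ln x] is extended by [0] there. Continuity on the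
    whole line is the form that [IVT_cor] asks for. *)
Lemma xlnx_continuous : continuity (fun x => x * ln x).
Proof.
have neg y : y <= 0 -> y * ln y = 0.
  by move=> y0; unfold ln; destruct (Rlt_dec 0 y) as [y1|y1]; [exfalso; lra | exact: Rmult_0_r].
move=> x; case: (Rtotal_order x 0) => [x0|[->|x0]].
- move=> e e0; exists (- x); split; first by lra.
  move=> y [_]; rewrite /= /R_dist => d; have y0 : y < 0.
    by have := Rle_abs (y - x); lra.
  by rewrite !neg ?Rminus_diag ?Rabs_R0; lra.
(* [2 * sqrt y < e] once [y < (e / 2)^2]; the bound [1] keeps [y] in the range of [xlnx_bound]. *)
- move=> e e0; exists (Rmin 1 ((e / 2) * (e / 2))); split.
    by apply: Rmin_glb_lt; [lra | apply: Rmult_lt_0_compat; lra].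
  move=> y [_]; rewrite /= /R_dist Rminus_0_r Rmult_0_l Rminus_0_r => d.
  case: (Rle_lt_dec y 0) => [/neg->|y0]; first by rewrite Rabs_R0; lra.
  rewrite Rabs_pos_eq in d; last by lra.
  have y1 : y < 1 by apply: Rlt_le_trans d (Rmin_l _ _).
  have ye : y < e / 2 * (e / 2) by apply: Rlt_le_trans d (Rmin_r _ _).
  apply: (Rle_lt_trans _ _ _ (xlnx_bound y0 y1)).
  suff : sqrt y < e / 2 by lra.
  by rewrite -(sqrt_square (e / 2)); [apply: sqrt_lt_1; lra | lra].
- apply: continuity_pt_mult.
    exact: derivable_continuous_pt (derivable_pt_id x).
  apply: derivable_continuous_pt; exists (/ x); exact: derivable_pt_lim_ln.
Qed.

Lemma Tp_continuous p : continuity (Tp p).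
Proof.
pose F x := / ln 2 * (- (x * ln x) - (1 - x) * ln (1 - x) + (1 - x) * ln (INR p - 1)).
have cF : continuity F.
  have c1 : continuity (fun x => 1 - x).
    apply: continuity_minus; first by apply: continuity_const.
    exact: derivable_continuous derivable_id.
  apply: continuity_scal; apply: continuity_plus.
    apply: continuity_minus; first exact/continuity_opp/xlnx_continuous.
    exact: (continuity_comp (fun x => 1 - x) (fun x => x * ln x) c1 xlnx_continuous).
  by apply: continuity_mult => //; apply: continuity_const.
move=> x e e0; have [d [d0 hd]] := cF x e e0.
exists d; split=> // y hy; rewrite !TpE /Rdiv ![_ * / _]Rmult_comm; exact: hd.
Qed.

Lemma Tp_inv p : (1 < p)%N -> Tp p (/ INR p) = log2 (INR p).
Proof.
move=> /INR_ge2 p2; have l2 := ln2_gt0.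
have -> : log2 (INR p) = ln (INR p) / ln 2 by [].
rewrite TpE; congr (_ / _).
have -> : 1 - / INR p = (INR p - 1) * / INR p by field; lra.
have ip0 : 0 < / INR p by apply: Rinv_0_lt_compat; lra.
rewrite ln_mult ?ln_Rinv; try lra.
by field; lra.
Qed.

Lemma Tp_1 p : Tp p 1 = 0.
Proof. by rewrite TpE ln_1 /Rdiv; ring. Qed.

Lemma Tinv_spec p y : (1 < p)%N -> 0 <= y <= log2 (INR p) ->
  / INR p <= Tinv p y <= 1 /\ Tp p (Tinv p y) = y.
Proof.
move=> p1 [y0 yp].
apply: (epsilon_spec (inhabits 0) (fun t => / INR p <= t <= 1 /\ Tp p t = y)).
have cont : continuity (fun x => Tp p x - y).
  by apply: continuity_minus; [exact: Tp_continuous | apply: continuity_const].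
have p2 := INR_ge2 p1.
have ip1 : / INR p <= 1 by rewrite -Rinv_1; apply: Rinv_le_contravar; lra.
case: (IVT_cor _ _ _ cont ip1) => [|z [hz ez]]; last by exists z; split; [|lra].
rewrite Tp_inv // Tp_1.
(* The end values are [log2 p - y] and [0 - y], whose product is nonpositive. *)
have := Rmult_le_pos (log2 (INR p) - y) y; lra.
Qed.

(** Once [mu c] is fixed, the entropy is largest when the remaining mass [w] is spread uniformly
    over the other [n - 1] points; Gibbs' inequality against that uniform law proves it for any
    [c]. *)
Lemma fano (T : finType) (mu : T -> R) (c : T) (n : nat) :
  #|T| = n -> (1 < n)%N ->
  (forall t, 0 <= mu t) -> Rsum mu = 1 ->
  - Rsum (fun t => xlog2 (mu t)) <= Tp n (mu c).
Proof.
move=> cardT /INR_ge2 p2 mu0 mu1; set w := 1 - mu c.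
have restE : \big[Rplus/R0]_(t | t != c) mu t = w.
  by move: mu1; rewrite /Rsum (bigD1 c) //= /w => <-; ring.
have w0 : 0 <= w.
  rewrite -restE; apply: (big_ind (fun x => 0 <= x)) => //; first exact: Rle_refl.
  exact: Rplus_le_le_0_compat.
have -> : Rsum (fun t => xlog2 (mu t)) = Rsum (fun t => mu t * ln (mu t)) / ln 2.
  rewrite /Rdiv Rmult_comm -RsumZ; apply: Rsum_ext => t; rewrite xlog2E /Rdiv; ring.
rewrite TpE -/w /Rdiv [- (Rsum _ * _)]Ropp_mult_distr_l.
apply: Rmult_le_compat_r; first exact/Rlt_le/Rinv_0_lt_compat/ln2_gt0.
rewrite /Rsum (bigD1 c) //=.
set S := (X in _ + X); suff : w * ln w - w * ln (INR n - 1) <= S by lra.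
rewrite /S {S}.
(* When [w = 0] the comparison law would vanish; then all other masses are [0] as well. *)
case: w0 => [w0|w0]; last first.
  rewrite -w0 Rmult_0_l Rmult_0_l big1; first by lra.
  move=> t tc; suff -> : mu t = 0 by rewrite Rmult_0_l.
  move: restE; rewrite (bigD1 t) //= -w0.
  have : 0 <= \big[Rplus/R0]_(i | (i != c) && (i != t)) mu i.
    apply: (big_ind (fun x => 0 <= x)) => //; first exact: Rle_refl.
    exact: Rplus_le_le_0_compat.
  by have := mu0 t; lra.
set q := w / (INR n - 1).
have q0 : 0 < q by apply: Rdiv_lt_0_compat; lra.
have lq : ln q = ln w - ln (INR n - 1).
  by rewrite /q /Rdiv ln_mult ?ln_Rinv; try lra; apply: Rinv_0_lt_compat; lra.
have cardc : INR #|[pred t | t != c]| = INR n - 1.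
  rewrite (@eq_card _ _ (predC1 c)) // cardC1 cardT.
  have n0 : (0 < n)%N by rewrite -cardT; apply/card_gt0P; exists c.
  by rewrite -[in RHS](prednK n0) S_INR; ring.
(* The linear terms of Gibbs' inequality cancel on summing, as both total masses are [w]. *)
have : \big[Rplus/R0]_(t | t != c) (mu t * (ln q + 1) + - q)
       <= \big[Rplus/R0]_(t | t != c) (mu t * ln (mu t)).
  by apply: Rsum_le => t _; have := gibbs_le (mu0 t) q0; lra.
rewrite big_split /= -big_distrl /= restE Rsum_const cardc lq.
have -> : (INR n - 1) * - q = - w by rewrite /q; field; lra.
lra.
Qed.

Lemma card_Zmod p : (1 < p)%N -> #|'Z_p| = p.
Proof. by move=> p1; rewrite card_ord Zp_cast. Qed.

(** Under additive noise a uniform input gives a uniform output, so the information is [log2 p]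
    minus the entropy of the noise. *)
Lemma mutual_info_shift p (mu : 'Z_p -> R) : (1 < p)%N ->
  (forall t, 0 <= mu t) -> Rsum mu = 1 ->
  mutual_info (fun u v : 'Z_p => / INR p * mu (v - u)%R)
    = log2 (INR p) + Rsum (fun t => xlog2 (mu t)).
Proof.
move=> p1 mu0 mu1; have p2 := INR_ge2 p1; have l2 := ln2_gt0.
have ip0 : 0 < / INR p by apply: Rinv_0_lt_compat; lra.
have shiftl (F : 'Z_p -> R) u : Rsum (fun v => F (v - u)%R) = Rsum F.
  by rewrite /Rsum [RHS](reindex_inj (addIr (- u)%R)).
have shiftr (F : 'Z_p -> R) v : Rsum (fun u => F (v - u)%R) = Rsum F.
  by rewrite /Rsum [RHS](reindex_inj (inj_comp (addrI v) oppr_inj)).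
rewrite /mutual_info /=.
pose term t := / INR p * (log2 (INR p) * mu t + xlog2 (mu t)).
have -> : log2 (INR p) + Rsum (fun t => xlog2 (mu t)) = Rsum (fun u : 'Z_p => Rsum term).
  by rewrite Rsum_cst card_Zmod // /term RsumZ RsumD RsumZ mu1; field; lra.
apply: Rsum_ext => u; rewrite -(shiftl term u); apply: Rsum_ext => v.
rewrite !RsumZ shiftl (shiftr mu) mu1 /term xlog2E /log2.
set m := mu _; have := mu0 (v - u)%R; rewrite -/m => m0.
case: Req_EM_T => /= [e|ne].
  have -> : m = 0 by case: (Rmult_integral _ _ e); lra.
  by field; lra.
have m1 : 0 < m by case: m0 => // e; case: ne; rewrite -e; ring.
have -> : / INR p * m / (/ INR p * 1 * (/ INR p * 1)) = INR p * m by field; lra.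
by rewrite ln_mult //; [field; lra | lra].
Qed.

(** Dividing by [N] bounds the entropy below, and Fano passes this to [Tp p (mu c)]. Since [Tinv]
    lies above [1 / p], a larger [mu c] would contradict [Tp_decreasing]. *)
Lemma Tinv_bound p (N : nat) (mu : 'Z_p -> R) (c : 'Z_p) : (1 < p)%N -> (0 < N)%N ->
  (forall t, 0 <= mu t) -> Rsum mu = 1 ->
  INR N * (log2 (INR p) + Rsum (fun t => xlog2 (mu t))) <= log2 (INR p) ->
  mu c <= Tinv p ((INR N - 1) / INR N * log2 (INR p)).
Proof.
move=> p1 N0 mu0 mu1 ic; have p2 := INR_ge2 p1.
have N1 : 1 <= INR N by have -> : 1 = INR 1 by []; apply: le_INR; lia.
have iN0 : 0 < / INR N by apply: Rinv_0_lt_compat; lra.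
set L := log2 (INR p) in ic *.
have L0 : 0 <= L.
  apply: Rmult_le_pos; last exact/Rlt_le/Rinv_0_lt_compat/ln2_gt0.
  by rewrite -ln_1; left; apply: ln_increasing; lra.
have -> : (INR N - 1) / INR N * L = L - / INR N * L by field; lra.
have iNL : 0 <= / INR N * L by apply: Rmult_le_pos; lra.
have iNL' : / INR N * L <= L.
  rewrite -[X in _ <= X]Rmult_1_l; apply: Rmult_le_compat_r => //.
  by rewrite -Rinv_1; apply: Rinv_le_contravar; lra.
have entropy : L - / INR N * L <= Tp p (mu c).
  have := fano c (card_Zmod p1) p1 mu0 mu1.
  have := Rmult_le_compat_l _ _ _ (Rlt_le _ _ iN0) ic.
  rewrite -Rmult_assoc Rinv_l ?Rmult_1_l; last by lra.
  lra.
have [|[t1 t2] t3] := @Tinv_spec p (L - / INR N * L) p1; first by rewrite -/L; lra.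
case: (Rle_lt_dec (mu c) (Tinv p (L - / INR N * L))) => // lt.
have muc1 : mu c <= 1.
  rewrite -mu1 /Rsum (bigD1 c) //= -[X in X <= _]Rplus_0_r.
  apply: Rplus_le_compat_l; apply: (big_ind (fun x => 0 <= x)) => //.
    exact: Rle_refl.
  exact: Rplus_le_le_0_compat.
by have := Tp_decreasing p1 t1 lt muc1; lra.
Qed.

(** * Characters of ['Z_p] *)

Notation C0 := ((R0, R0) : Cplx).
Notation C1 := ((R1, R0) : Cplx).

Lemma CaddA : associative Cadd.
Proof. by move=> x y z; rewrite /Cadd /= !Rplus_assoc. Qed.
Lemma CaddC : commutative Cadd.
Proof. by move=> x y; rewrite /Cadd /= Rplus_comm (Rplus_comm x.2). Qed.
Lemma Cadd0 : left_id C0 Cadd.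
Proof. by case=> x y; rewrite /Cadd /= !Rplus_0_l. Qed.
Lemma CmulA : associative Cmul.
Proof. by case=> [x x'] [y y'] [z z']; rewrite /Cmul /=; congr pair; ring. Qed.
Lemma CmulC : commutative Cmul.
Proof. by case=> [x x'] [y y']; rewrite /Cmul /=; congr pair; ring. Qed.
Lemma Cmul1 : left_id C1 Cmul.
Proof. by case=> x y; rewrite /Cmul /=; congr pair; ring. Qed.
Lemma Cmul0 : left_zero C0 Cmul.
Proof. by case=> x y; rewrite /Cmul /=; congr pair; ring. Qed.
Lemma CmulC0 : right_zero C0 Cmul.
Proof. by case=> x y; rewrite /Cmul /=; congr pair; ring. Qed.
Lemma CmulDl : left_distributive Cmul Cadd.
Proof. by case=> [x x'] [y y'] [z z']; rewrite /Cmul /Cadd /=; congr pair; ring. Qed.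
Lemma CmulDr : right_distributive Cmul Cadd.
Proof. by case=> [x x'] [y y'] [z z']; rewrite /Cmul /Cadd /=; congr pair; ring. Qed.

HB.instance Definition _ := Monoid.isComLaw.Build Cplx C0 Cadd CaddA CaddC Cadd0.
HB.instance Definition _ := Monoid.isComLaw.Build Cplx C1 Cmul CmulA CmulC Cmul1.
HB.instance Definition _ := Monoid.isMulLaw.Build Cplx C0 Cmul Cmul0 CmulC0.
HB.instance Definition _ := Monoid.isAddLaw.Build Cplx Cmul Cadd CmulDl CmulDr.

Lemma CscalE a z : Cscal a z = Cmul (a, 0) z.
Proof. by case: z => x y; rewrite /Cscal /Cmul /=; congr pair; ring. Qed.

Lemma CsumE (T : finType) (F : T -> Cplx) : Csum F = \big[Cadd/C0]_(t : T) F t.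
Proof.
apply: (big_ind3 (fun x y z => (x, y) = z)) => //; last by move=> i _; case: (F i).
by move=> x1 x2 x3 y1 y2 y3 <- <-.
Qed.

Lemma CpowD z m n : Cpow z (m + n) = Cmul (Cpow z m) (Cpow z n).
Proof. by elim: m => [|m IHm] /=; rewrite ?Cmul1 // IHm CmulA. Qed.

Lemma Cpow_iter z n : Cpow z n = iter n (Cmul z) C1.
Proof. by elim: n => //= n ->. Qed.

Lemma CpowM z m n : Cpow z (m * n) = Cpow (Cpow z m) n.
Proof. by elim: n => [|n IHn]; rewrite ?muln0 // mulnS CpowD IHn. Qed.

Lemma Cpow1 n : Cpow C1 n = C1.
Proof. by elim: n => //= n ->; rewrite Cmul1. Qed.

Lemma Cpow_omega p n :
  Cpow (omega p) n = (cos (INR n * (2 * PI / INR p)), sin (INR n * (2 * PI / INR p))).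
Proof.
elim: n => [|n IHn]; first by rewrite Rmult_0_l cos_0 sin_0.
rewrite [LHS]/= IHn S_INR Rmult_plus_distr_r Rmult_1_l cos_plus sin_plus.
by rewrite /Cmul /=; congr pair; ring.
Qed.

Section Fourier.
Variable p : nat.
Hypothesis p1 : (1 < p)%N.

Lemma omega_p : Cpow (omega p) p = C1.
Proof.
rewrite Cpow_omega; have p2 := INR_ge2 p1.
have -> : INR p * (2 * PI / INR p) = 2 * PI by field; lra.
by rewrite cos_2PI sin_2PI.
Qed.

(** After reduction of [n] to [0 < r < p], the real part is [1 - 2 sin^2 (PI r / p)], and this sine
    is positive. *)
Lemma omega_neq1 n : ~~ (p %| n)%N -> Cpow (omega p) n <> C1.
Proof.
move=> pn; rewrite (divn_eq n p) CpowD mulnC CpowM omega_p Cpow1 Cmul1.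
rewrite Cpow_omega => -[co _].
have r0 : (0 < n %% p)%N by rewrite lt0n.
have rp : (n %% p < p)%N by rewrite ltn_mod; lia.
have R0' : 0 < INR (n %% p) by apply: lt_0_INR; lia.
have Rp : INR (n %% p) < INR p by apply: lt_INR; lia.
move: co; set r := INR (n %% p) in R0' Rp *.
have -> : r * (2 * PI / INR p) = 2 * (PI * (r / INR p)) by field; lra.
have q0 : 0 < r / INR p by apply: Rdiv_lt_0_compat; lra.
have q1 : r / INR p < 1.
  by apply: (Rmult_lt_reg_r (INR p)); [lra | rewrite /Rdiv Rmult_assoc Rinv_l; lra].
have pi0 := PI_RGT_0.
have : 0 < sin (PI * (r / INR p)).
  apply: sin_gt_0; first exact: Rmult_lt_0_compat.
  by have := Rmult_lt_compat_l _ _ _ pi0 q1; lra.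
rewrite cos_2a_sin => s0; have := Rmult_lt_0_compat _ _ s0 s0; lra.
Qed.

Lemma Csum_geometric z n : Cmul (Cadd z (-1, 0)) (\big[Cadd/C0]_(0 <= k < n) Cpow z k)
  = Cadd (Cpow z n) (-1, 0).
Proof.
elim: n => [|n IHn].
  by rewrite big_nil CmulC0 /Cadd /=; congr pair; ring.
rewrite big_nat_recr //= CmulDr IHn.
by case: z (Cpow z n) {IHn} => [x x'] [y y']; rewrite /Cmul /Cadd /=; congr pair; ring.
Qed.

Lemma Cmul_eq0 z w : z <> C0 -> Cmul z w = C0 -> w = C0.
Proof.
case: z w => [x x'] [y y'] nz [e1 e2].
have n0 : x * x + x' * x' <> 0.
  move=> n0; have := Rle_0_sqr x'; have := Rle_0_sqr x; rewrite /Rsqr => sx sx'.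
  by apply: nz; congr pair; apply: Rsqr_0_uniq; rewrite /Rsqr; lra.
(* Multiply [z w = 0] by the conjugate of [z]. *)
congr pair; apply: (Rmult_eq_reg_l _ _ _ _ n0); rewrite Rmult_0_r.
  transitivity (x * (x * y - x' * y') + x' * (x * y' + x' * y)); first by ring.
  by rewrite e1 e2; ring.
transitivity (x * (x * y' + x' * y) - x' * (x * y - x' * y')); first by ring.
by rewrite e1 e2; ring.
Qed.

(** Orthogonality of characters: if [omega^n] is not [1], the geometric sum times [omega^n - 1] is
    [omega^(n p) - 1 = 0]. *)
Lemma Csum_omega n : Csum (fun k : 'Z_p => Cpow (omega p) (n * k))
  = if (p %| n)%N then (INR p, 0) else C0.
Proof.
rewrite CsumE; under eq_bigr do rewrite CpowM.
rewrite -(big_mkord xpredT (fun k => Cpow (Cpow (omega p) n) k)) Zp_cast //.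
case: ifPn => [/dvdnP[k ->]|pn].
  rewrite mulnC CpowM omega_p Cpow1; under eq_bigr do rewrite Cpow1.
  elim: p => [|m IHm]; first by rewrite big_nil.
  by rewrite big_nat_recr // IHm S_INR; congr pair; exact: Rplus_0_l.
apply: (@Cmul_eq0 (Cadd (Cpow (omega p) n) (-1, 0))).
  move: (omega_neq1 pn); case: (Cpow _ _) => x y ne [e1 e2]; apply: ne.
  by congr pair; lra.
rewrite Csum_geometric -CpowM mulnC CpowM omega_p Cpow1 /Cadd /=; congr pair; ring.
Qed.

(* Parametrising the [m]-fold convolution power by the [m]-element subset [A]
   of a larger set of independent copies of [mu] makes the copies outside [A]
   disappear through [Rsum mu = 1]. *)
Lemma convolution_fourier (mu : 'Z_p -> R) M (A : {set 'I_M}) (c : 'Z_p) :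
  Rsum mu = 1 ->
  Cscal (/ INR p) (Csum (fun k : 'Z_p => Cmul (Cpow (omega p) (c * k))
     (Cpow (Csum (fun j : 'Z_p => Cscal (mu j) (Cpow (omega p) (j * k)))) #|A|)))
  = (Rsum (fun j : {ffun 'I_M -> 'Z_p} =>
       if (c + \sum_(t in A) j t == 0)%R then \big[Rmult/R1]_t mu (j t) else 0), 0).
Proof.
move=> mu1; have p2 := INR_ge2 p1.
(* Exponents of [omega] are natural numbers, so the sum is formed on representatives; [nE] returns
   to ['Z_p]. *)
pose n (j : {ffun 'I_M -> 'Z_p}) := (c + \sum_(t in A) j t)%N.
pose w (j : {ffun 'I_M -> 'Z_p}) := \big[Rmult/R1]_t mu (j t).
have nE j : (p %| n j)%N = (c + \sum_(t in A) j t == 0)%R.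
  rewrite -[RHS](_ : ((n j)%:R == 0 :> 'Z_p)%R = _); last first.
    rewrite /n natrD natr_Zp natr_sum; congr (_ + _ == _)%R.
    by apply: eq_bigr => t _; rewrite natr_Zp.
  by rewrite -val_eqE /= val_Zp_nat.
have term (k : 'Z_p) : Cmul (Cpow (omega p) (c * k))
    (Cpow (Csum (fun j : 'Z_p => Cscal (mu j) (Cpow (omega p) (j * k)))) #|A|)
  = \big[Cadd/C0]_j Cmul (w j, 0) (Cpow (omega p) (n j * k)).
  pose F (t : 'I_M) (j : 'Z_p) :=
    Cmul (mu j, 0) (if t \in A then Cpow (omega p) (j * k) else C1).
  have -> : Cpow (Csum (fun j : 'Z_p => Cscal (mu j) (Cpow (omega p) (j * k)))) #|A|
    = \big[Cmul/C1]_t \big[Cadd/C0]_j F t j.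
    rewrite [RHS](bigID (mem A)) /= [X in Cmul _ X]big1.
      rewrite [RHS]CmulC Cmul1 Cpow_iter -big_const; apply: eq_bigr => t tA.
      by rewrite CsumE; apply: eq_bigr => j _; rewrite /F tA CscalE.
    move=> t tA; under eq_bigr => j _ do rewrite /F (negPf tA) CmulC Cmul1.
    rewrite -CsumE /Csum /=; congr pair; first exact: mu1.
    by rewrite Rsum_cst Rmult_0_r.
  rewrite bigA_distr_bigA big_distrr /=; apply: eq_bigr => j _.
  rewrite /F big_split /= CmulC -CmulA; congr Cmul.
    rewrite /w; apply: (big_ind2 (fun (x : R) z => z = (x, 0) :> Cplx)) => //.
    by move=> x1 z1 x2 z2 -> ->; rewrite /Cmul /=; congr pair; ring.
  rewrite /n mulnDl CpowD CmulC; congr Cmul.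
  rewrite big_distrl -big_mkcond /=.
  apply: (big_ind2 (fun z m => z = Cpow (omega p) m)) => //.
  by move=> z1 m1 z2 m2 -> ->; rewrite CpowD.
rewrite CsumE; under eq_bigr do rewrite term.
rewrite exchange_big CscalE big_distrr /=.
transitivity (\big[Cadd/C0]_(j : {ffun 'I_M -> 'Z_p})
    ((if (c + \sum_(t in A) j t == 0)%R then w j else 0, 0) : Cplx)).
  apply: eq_bigr => j _; rewrite -big_distrr -CsumE Csum_omega nE /=.
  by case: ifP => _; rewrite /Cmul /=; congr pair; field; lra.
by rewrite -CsumE /Csum /=; congr pair; rewrite Rsum_cst Rmult_0_r.
Qed.

End Fourier.

(** * Boxes and their noise *)

Lemma mutual_info_ext (U V : finType) (J K : U -> V -> R) :
  (forall u v, J u v = K u v) -> mutual_info J = mutual_info K.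
Proof.
move=> JK; apply: Rsum_ext => u; apply: Rsum_ext => v /=; rewrite JK.
by rewrite (Rsum_ext (JK u)) (Rsum_ext (fun u' => JK u' v)).
Qed.

Lemma Rprod_const M (x : R) : \big[Rmult/R1]_(k < M) x = x ^ M.
Proof. by rewrite big_const_ord; elim: M => //= M ->. Qed.

(** Each fiber has [|T|^(N-1)] elements; the factor [INR #|T|] on the left avoids the exponent
    [N - 1]. *)
Lemma Rsum_ffun_fiber (T : finType) N (i : 'I_N) (u : T) (C : R) :
  INR #|T| * Rsum (fun x : {ffun 'I_N -> T} => if x i == u then C else 0)
  = C * INR #|T| ^ N.
Proof.
pose F (k : 'I_N) (z : T) := if k == i then (if z == u then 1 else 0) else 1.
have -> : Rsum (fun x : {ffun 'I_N -> T} => if x i == u then C else 0)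
  = C * \big[Rmult/R1]_k \big[Rplus/R0]_z F k z.
  rewrite bigA_distr_bigA /= -RsumZ; apply: Rsum_ext => x.
  rewrite (bigD1 i) //= /F eqxx big1; last by move=> k /negPf ->.
  by case: ifP => _; ring.
rewrite -Rprod_const (bigD1 i) //= [in RHS](bigD1 i) //=.
have -> : \big[Rplus/R0]_z F i z = 1.
  by rewrite /F eqxx; exact: (Rsum_delta (fun=> 1)).
under eq_bigr => k /negPf ki do
  rewrite /F ki (Rsum_cst T 1 : \big[Rplus/R0]_(z : T) 1 = _) Rmult_1_r.
by rewrite Rmult_1_l -!Rmult_assoc [_ * C]Rmult_comm.
Qed.

(** A maximum of [2] kills every mixed coefficient except the one of [x y]; the rest depends on one
    variable only. *)
Lemma Delta2_form p (f : 'Z_p -> 'Z_p -> 'Z_p) : (1 < p)%N -> Delta_eq f 2 ->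
  exists lam g h, forall x y, (f x y = lam * x * y + g x + h y)%R.
Proof.
move=> p1 [lam [rep Dmax]].
have p0 : (0 < p)%N by lia.
pose i0 := Ordinal p0; pose i1 := Ordinal p1.
have lam0 (i j : 'I_p) : i != i0 -> j != i0 -> (i != i1) || (j != i1) ->
    lam i j = 0%R.
  rewrite -!val_eqE /= => i_gt0 j_gt0 ij1; apply/eqP; apply: contraT => nz.
  have : (i + j <= 2)%N.
    rewrite Dmax (leq_bigmax_cond (i, j)) //=.
    by apply/and3P; split=> //; rewrite ?lt0n.
  by lia.
exists (lam i1 i1), (fun x => \sum_(i < p) lam i i0 * x ^+ i)%R.
(* The constant term already belongs to [g], hence [j != i0]. *)
exists (fun y => \sum_(j < p | j != i0) lam i0 j * y ^+ j)%R => x y.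
rewrite rep.
under eq_bigr => i _ do rewrite (bigD1 i0) //= expr0 mulr1.
rewrite big_split /= [X in (_ + X)%R](bigD1 i0) //=.
rewrite [X in (_ + (_ + X))%R](bigD1 i1) //= [X in (_ + (_ + (X + _)))%R](bigD1 i1) //=.
rewrite !expr1 !mulrA.
rewrite [X in (_ + (_ + (_ + X + _)))%R]big1; last first.
  by move=> j /andP[j0 j1]; rewrite lam0 ?j1 ?orbT // !mul0r.
rewrite [X in (_ + (_ + (_ + X)))%R]big1; last first.
  move=> i /andP[ni0 ni1]; rewrite big1 // => j nj0.
  by rewrite lam0 ?ni1 // !mul0r.
rewrite !addr0 [LHS]addrA [LHS]addrC [LHS]addrA; congr (_ + _)%R.
by apply: eq_bigr => j _; rewrite expr0 mul1r.
Qed.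

Lemma unit_Zp_prime p (x : 'Z_p) : prime p -> x != 0%R -> x \is a GRing.unit.
Proof.
move=> pp nx; have p1 := prime_gt1 pp.
rewrite -[x]natr_Zp unitZpE // prime_coprime // gtnNdvd //.
  by rewrite lt0n; move: nx; rewrite -val_eqE.
by rewrite -[X in (_ < X)%N](Zp_cast p1); exact: ltn_ord.
Qed.

Section Noise.
Variables (p : nat) (f : 'Z_p -> 'Z_p -> 'Z_p) (P : box p) (M : nat).
Hypothesis p1 : (1 < p)%N.
Notation vec := {ffun 'I_M -> 'Z_p}.
Variables (U : vec -> vec -> vec -> 'I_M -> 'Z_p) (V : 'I_M -> 'Z_p).
Hypothesis U_causal : forall (k : 'I_M) (r s a r' s' a' : vec),
  (forall j : 'I_M, (j < k)%N -> [/\ r j = r' j, s j = s' j & a j = a' j]) ->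
  U r s a k = U r' s' a' k.

(** The [j] for which [b = a - f(x, y) + j], as in [nu], at the masked inputs. *)
Definition noise_of (r s a b : vec) : vec :=
  [ffun k => f (U r s a k + r k) (V k + s k) - a k + b k]%R.

Definition to_noise (z : vec * vec * vec * vec) : vec * vec * vec * vec :=
  let: (r, s, a, b) := z in
  ([ffun k => U r s a k + r k]%R, [ffun k => V k + s k]%R, a, noise_of r s a b).

(** [V] is fixed, so [s] is recovered at once; [r] is recovered index by index, as [U] at [k] sees
    only earlier entries; then [b] follows. On a finite type this makes [to_noise] a change of
    variables. *)
Lemma to_noise_inj : injective to_noise.
Proof.
move=> [[[r s] a] b] [[[r' s'] a'] b'] [er es ea en]; subst a'.
have ss' : s = s'.
  apply/ffunP => k; move/ffunP: es => /(_ k); rewrite !ffunE; exact: addrI.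
subst s'.
have rr n (k : 'I_M) : (k < n)%N -> r k = r' k.
  elim: n k => // n IHn k kn.
  have Uk : U r s a k = U r' s a k.
    by apply: U_causal => j jk; split=> //; apply: IHn; lia.
  by move/ffunP: er => /(_ k); rewrite !ffunE Uk; exact: addrI.
have {rr} er' : r = r' by apply/ffunP => k; exact: (rr k.+1).
subst r'; suff -> : b = b' by [].
by apply/ffunP => k; move/ffunP: en => /(_ k); rewrite !ffunE; exact: addrI.
Qed.

(* By causality the shared randomness can be traded for the box inputs, and
   then Bob's outputs for the noises, so uniform randomness makes the noises
   independent with law [nu]. *)
Lemma noise_law (G : vec -> R) :
  Rsum (fun rs : vec * vec => Rsum (fun a : vec => Rsum (fun b : vec =>
    G (noise_of rs.1 rs.2 a b) * \big[Rmult/R1]_(k < M)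
      P (a k) (b k) (U rs.1 rs.2 a k + rs.1 k)%R (V k + rs.2 k)%R)))
  = (INR p ^ 2) ^ M * Rsum (fun j : vec => G j * \big[Rmult/R1]_(k < M) nu f P (j k)).
Proof.
pose H (z : vec * vec * vec * vec) := let: (x, y, a, j) := z in
  G j * \big[Rmult/R1]_(k < M) P (a k) (a k - f (x k) (y k) + j k)%R (x k) (y k).
transitivity (\big[Rplus/R0]_z H z).
  rewrite /Rsum !pair_bigA /= [RHS](reindex_inj to_noise_inj) /=.
  apply: eq_bigr => -[[[r s] a] b] _ /=; congr (_ * _).
  apply: eq_bigr => k _; rewrite !ffunE.
  by rewrite !addrA subrK subrr add0r.
have p2 := INR_ge2 p1.
transitivity (\big[Rplus/R0]_(j : vec) \big[Rplus/R0]_(x : vec) \big[Rplus/R0]_(y : vec)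
  \big[Rplus/R0]_(a : vec) H (x, y, a, j)).
  rewrite [RHS]exchange_big; under [in RHS]eq_bigr do rewrite exchange_big.
  under [in RHS]eq_bigr do under eq_bigr do rewrite exchange_big.
  by rewrite /= !pair_bigA /=; apply: eq_bigr => -[[[x y] a] j].
have nuE i : INR p ^ 2 * nu f P i = \big[Rplus/R0]_(x : 'Z_p) \big[Rplus/R0]_(y : 'Z_p)
    \big[Rplus/R0]_(k : 'Z_p) P k (k - f x y + i)%R x y.
  rewrite /nu -Rmult_assoc Rinv_r ?Rmult_1_l //; apply: pow_nonzero; lra.
rewrite -RsumZ; apply: eq_bigr => j _.
rewrite -Rprod_const -Rmult_assoc [_ * G j]Rmult_comm Rmult_assoc -big_split /=.
under [in RHS]eq_bigr => k _ do rewrite nuE.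
rewrite [in RHS]bigA_distr_bigA big_distrr /=; apply: eq_bigr => x _.
rewrite [in RHS]bigA_distr_bigA big_distrr /=; apply: eq_bigr => y _.
by rewrite [in RHS]bigA_distr_bigA big_distrr.
Qed.

End Noise.

Lemma nu_ge0 p (f : 'Z_p -> 'Z_p -> 'Z_p) (P : box p) j : (1 < p)%N -> is_box P ->
  0 <= nu f P j.
Proof.
move=> /INR_ge2 p2 [P0 _]; apply: Rmult_le_pos.
  by apply/Rlt_le/Rinv_0_lt_compat/pow_lt; lra.
by do 3!apply: Rsum_ge0 => ?.
Qed.

(** For fixed [x], [y], [k], Bob's output runs over all of ['Z_p] with [j], so each input pair
    contributes [1]. *)
Lemma nu_sum1 p (f : 'Z_p -> 'Z_p -> 'Z_p) (P : box p) : (1 < p)%N -> is_box P ->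
  Rsum (nu f P) = 1.
Proof.
move=> p1 [_ P1]; have p2 := INR_ge2 p1; rewrite /nu RsumZ.
suff -> : Rsum (fun j => Rsum (fun x : 'Z_p => Rsum (fun y : 'Z_p =>
    Rsum (fun k : 'Z_p => P k (k - f x y + j)%R x y)))) = INR p ^ 2.
  by field; lra.
rewrite /Rsum exchange_big /=.
transitivity (Rsum (fun x : 'Z_p => Rsum (fun y : 'Z_p => 1))).
  apply: eq_bigr => x _; rewrite exchange_big; apply: eq_bigr => y _.
  rewrite exchange_big -(P1 x y); apply: eq_bigr => k _.
  by rewrite [RHS](reindex_inj (addrI (k - f x y)%R)).
by rewrite !Rsum_cst card_Zmod //; ring.
Qed.

(** * The binary pyramid *)

Module BoxDecoding.
Import ring.
(* What Bob recovers from one box use: the boxed term [lam * u * v] selects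
   between the two messages [c0] and [c1], up to the noise of the box. *)
Lemma decode_step (K : comUnitRingType) (lam c0 c1 v r s a b G H : K) :
  lam \is a GRing.unit ->
  let u := (lam^-1 * (c1 - c0))%R in
  (c0 + v * (c1 - c0) =
     (c0 + (a - G - lam * u * s)) - (b + H + lam * r * (v + s))
     + (lam * (u + r) * (v + s) + G + H - a + b))%R.
Proof.
move=> ulam u; have lu : (c1 - c0 = lam * u)%R by rewrite /u mulrA divrr // mul1r.
by rewrite lu; ring.
Qed.
End BoxDecoding.

Section Pyramid.
Variables (p : nat) (f : 'Z_p -> 'Z_p -> 'Z_p) (P : box p).
Hypotheses (p1 : (1 < p)%N) (boxP : is_box P).
Variables (lam : 'Z_p) (g h : 'Z_p -> 'Z_p).
Hypothesis lam_unit : lam \is a GRing.unit.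
Hypothesis fE : forall x y, (f x y = lam * x * y + g x + h y)%R.
Variables (m N : nat).
Hypothesis N_le : (N <= 2 ^ m)%N.

Let W := (2 ^ m)%N.
(** Each layer gets [W] slots, more than the tree uses, so that division by [W] recovers layer and
    position. *)
Let M := (m * W)%N.
Notation vec := {ffun 'I_M -> 'Z_p}.

(** The default [0] also pads Alice's [N] data to the [2 ^ m] leaves. *)
Definition entry n (o : {ffun 'I_n -> 'Z_p}) (t : nat) : 'Z_p :=
  if insub t is Some i then o i else 0%R.

Lemma entryE n (o : {ffun 'I_n -> 'Z_p}) (i : 'I_n) : entry o i = o i.
Proof. by rewrite /entry valK. Qed.

(* The box joining the two children of position [pos] in layer [l].  Reducing
   [pos] modulo [W] keeps layers disjoint even at positions off the tree. *)
Definition slot (l pos : nat) : nat := (l * W + pos %% W)%N.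

(** In [lam (u + r)(v + s) = lam u v + lam u s + lam r (v + s)], Alice can cancel [lam u s] and [g],
    while Bob cancels [lam r (v + s)] and [h] in [correction]. A node carries [c0] plus Alice's
    share of [lam u v]. *)
Fixpoint code (x : nat -> 'Z_p) (r s a : vec) (l pos : nat) : 'Z_p :=
  if l is l'.+1 then
    let t := slot l' pos in
    let c0 := code x r s a l' (2 * pos) in
    let u := (lam^-1 * (code x r s a l' (2 * pos).+1 - c0))%R in
    (c0 + (entry a t - g (u + entry r t) - lam * u * entry s t))%R
  else x pos.

Definition slope x r s a (t : nat) : 'Z_p :=
  let c := code x r s a (t %/ W) in
  (lam^-1 * (c (2 * (t %% W)).+1 - c (2 * (t %% W))%N))%R.

(** The binary digit of [y] at the layer of box [t]: which child leads to leaf [y]. *)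
Definition choice_bit (y t : nat) : 'Z_p := (odd (y %/ 2 ^ (t %/ W)) : nat)%:R%R.

Definition alice_in (k : 'I_M) (xr : {ffun 'I_N -> 'Z_p} * (vec * vec)) (a : vec) :=
  (slope (entry xr.1) xr.2.1 xr.2.2 a k + xr.2.1 k)%R.

Definition alice_msg (xr : {ffun 'I_N -> 'Z_p} * (vec * vec)) (a : vec) :=
  code (entry xr.1) xr.2.1 xr.2.2 a m 0.

Definition bob_in (k : 'I_M) (yqr : 'I_N * 'Z_p * (vec * vec)) (b : vec) :=
  (choice_bit yqr.1.1 k + yqr.2.2 k)%R.

Definition correction (y : nat) (r s b : vec) (t : nat) : 'Z_p :=
  let w := (choice_bit y t + entry s t)%R in
  (entry b t + h w + lam * entry r t * w)%R.

(** The ancestor of leaf [y] joined by a box of layer [l] has position [y %/ 2 ^ l.+1]. *)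
Definition bob_out (yqr : 'I_N * 'Z_p * (vec * vec)) (b : vec) : 'Z_p :=
  let y : nat := yqr.1.1 in
  (yqr.1.2 - \sum_(l < m) correction y yqr.2.1 yqr.2.2 b (slot l (y %/ 2 ^ l.+1)))%R.

(** * Layers of the tree and causality *)

Lemma W_gt0 : (0 < W)%N.
Proof. by rewrite expn_gt0. Qed.

Lemma slot_lt l l' pos : (l < l')%N -> (slot l pos < l' * W)%N.
Proof.
move=> ll'; rewrite /slot; have := ltn_pmod pos W_gt0.
by have := leq_mul ll' (leqnn W); rewrite mulSn; lia.
Qed.

Lemma slot_div l pos : (slot l pos %/ W = l)%N.
Proof. by rewrite /slot divnMDl ?W_gt0 // divn_small ?addn0 // ltn_pmod // W_gt0. Qed.

Lemma slot_mod l pos : (slot l pos %% W = pos %% W)%N.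
Proof. by rewrite /slot modnMDl modn_mod. Qed.

Lemma entry_causal (n : nat) (o o' : vec) :
  (forall j : 'I_M, (j < n)%N -> o j = o' j) ->
  forall t, (t < n)%N -> entry o t = entry o' t.
Proof. by move=> oo' t tn; rewrite /entry; case: insubP => // i _ it; apply: oo'; rewrite it. Qed.

Lemma code_causal x (r s a r' s' a' : vec) l :
  (forall j : 'I_M, (j < l * W)%N -> [/\ r j = r' j, s j = s' j & a j = a' j]) ->
  forall pos, code x r s a l pos = code x r' s' a' l pos.
Proof.
elim: l => [//|l IHl] eqs pos /=.
have c : code x r s a l =1 code x r' s' a' l.
  by apply: IHl => j jl; apply: eqs; rewrite mulSn; lia.
have tl := slot_lt pos (ltnSn l).
have er : entry r (slot l pos) = entry r' (slot l pos).
  by apply: entry_causal tl => j /eqs[].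
have es : entry s (slot l pos) = entry s' (slot l pos).
  by apply: entry_causal tl => j /eqs[].
have ea : entry a (slot l pos) = entry a' (slot l pos).
  by apply: entry_causal tl => j /eqs[].
by rewrite !c er es ea.
Qed.

Lemma slope_causal x (r s a r' s' a' : vec) (k : 'I_M) :
  (forall j : 'I_M, (j < k)%N -> [/\ r j = r' j, s j = s' j & a j = a' j]) ->
  slope x r s a k = slope x r' s' a' k.
Proof.
move=> eqs; have c := @code_causal x r s a r' s' a' (k %/ W).
rewrite /slope !c // => j jk; apply: eqs; apply: leq_trans jk _; exact: leq_trunc_div.
Qed.

Lemma alice_causal : causal alice_in.
Proof.
move=> k [x [r s]] a a' eqa; congr (_ + _)%R; apply: slope_causal => j jk /=.
by split=> //; apply: eqa.
Qed.

(** Bob's inputs depend on [y] and the masks alone, never on box outputs. *)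
Lemma bob_causal : causal bob_in.
Proof. by []. Qed.

(** * Decoding along Bob's path *)

Definition path_node (y : nat) (l : 'I_m) : 'I_M :=
  Ordinal (slot_lt (y %/ 2 ^ l.+1) (ltn_ord l)).

Definition path_set (y : nat) : {set 'I_M} := [set path_node y l | l : 'I_m].

Lemma path_node_inj y : injective (path_node y).
Proof.
move=> l l' /(congr1 (fun i : 'I_M => i %/ W)%N) /=.
by rewrite !slot_div => /val_inj.
Qed.

Lemma card_path y : #|path_set y| = m.
Proof. by rewrite card_imset ?card_ord //; exact: path_node_inj. Qed.

Notation noise x y r s a b :=
  (noise_of f (fun r s a (k : 'I_M) => slope x r s a k)
    (fun k : 'I_M => choice_bit y k) r s a b).

(** Each step towards the root trades the child's code for its parent's, at the cost of one
    correction and one noise. *)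
Lemma code_layer x y (r s a b : vec) l : (y < W)%N -> (l <= m)%N ->
  (x y = code x r s a l (y %/ 2 ^ l)
    + \sum_(k < l) (entry (noise x y r s a b) (slot k (y %/ 2 ^ k.+1))
                    - correction y r s b (slot k (y %/ 2 ^ k.+1))))%R.
Proof.
move=> yW; elim: l => [|l IHl] lm; first by rewrite big_ord0 addr0 divn1.
rewrite [LHS]IHl; last by lia.
rewrite big_ord_recr /= [in RHS]addrA addrAC; congr (_ + _)%R.
set pos := (y %/ 2 ^ l.+1)%N; set t := slot l pos.
(* As [y < W], the reduction modulo [W] in [slot] changes nothing on the path. *)
have posW : (pos %% W = pos)%N by rewrite modn_small //; apply: leq_ltn_trans (leq_div _ _) yW.
have tM : (t < M)%N by apply: slot_lt.
have yl : (y %/ 2 ^ l = 2 * pos + odd (y %/ 2 ^ l))%N.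
  by rewrite /pos expnSr divnMA [LHS](divn_eq _ 2) modn2 mulnC.
have -> : entry (noise x y r s a b) t =
    (f (slope x r s a t + entry r t) (choice_bit y t + entry s t) - entry a t + entry b t)%R.
  by rewrite -[t]/(val (Ordinal tM)) !entryE ffunE.
rewrite /slope /correction /choice_bit /t slot_div slot_mod posW -/t fE.
set c0 := code x r s a l (2 * pos); set c1 := code x r s a l (2 * pos).+1.
have -> : code x r s a l (y %/ 2 ^ l) = (c0 + (odd (y %/ 2 ^ l))%:R * (c1 - c0))%R.
  rewrite {1}yl; case: (odd _); last by rewrite addn0 mul0r addr0.
  by rewrite addn1 mul1r addrC subrK.
rewrite [(_ + (_ - _))%R]addrCA [RHS]addrC.
exact: BoxDecoding.decode_step.
Qed.


(** At layer [m] the position is [0], the root, whose code is the message; Bob's corrections cancel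
    and only noise is left. *)
Lemma bob_outE (x : {ffun 'I_N -> 'Z_p}) (y : 'I_N) (r s a b : vec) :
  bob_out (y, alice_msg (x, (r, s)) a, (r, s)) b
  = (x y - \sum_(t in path_set y) noise (entry x) y r s a b t)%R.
Proof.
have yW : (y < W)%N by apply: leq_trans (ltn_ord y) N_le.
have := code_layer (entry x) r s a b yW (leqnn m).
rewrite entryE divn_small // /bob_out /alice_msg /= => ->.
rewrite big_imset /=; last by move=> l l' _ _; exact: path_node_inj.
rewrite -addrA -sumrB; congr (_ + _)%R.
rewrite -sumrN; apply: eq_bigr => l _.
by rewrite -[slot _ _]/(val (path_node y l)) entryE addrAC subrr sub0r.
Qed.

(** A path enters only through its cardinality [m], so the law of the error is the same for every
    [y]. *)
Lemma ic_lhsE (y : nat) (c : 'Z_p) : Re (ic_lhs f P m c)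
  = Rsum (fun j : vec => if (c + \sum_(t in path_set y) j t == 0)%R
                         then \big[Rmult/R1]_t nu f P (j t) else 0).
Proof.
have := convolution_fourier p1 (path_set y) c (nu_sum1 f p1 boxP).
by rewrite card_path /ic_lhs /nu_hat /Re => ->.
Qed.

(** For each fixed [x], [noise_law] makes the noises independent and its factor [(p^2)^M] cancels
    the weight of the masks. Averaging over the [x] with [x y = u] leaves [1 / p]. *)
Lemma joint_law (y : 'I_N) (u v : 'Z_p) :
  protocol_joint P (fun _ : vec * vec => / (INR p ^ M * INR p ^ M))
    alice_in alice_msg bob_in bob_out y u v
  = / INR p * Re (ic_lhs f P m (v - u)%R).
Proof.
have p2 := INR_ge2 p1.
have pn n : INR p ^ n <> 0 by apply: pow_nonzero; lra.
rewrite /protocol_joint.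
transitivity (Rsum (fun x : {ffun 'I_N -> 'Z_p} =>
    if x y == u then / INR p ^ N * Re (ic_lhs f P m (v - u)%R) else 0)).
  apply: Rsum_ext => x; case: eqP => // xy.
  (* [G] tests whether the path noises turn [u] into the output [v]. *)
  pose G (j : vec) := if (v - u + \sum_(t in path_set y) j t == 0)%R then 1 else 0.
  have := @noise_law p f P M p1 (fun r s a (k : 'I_M) => slope (entry x) r s a k)
    (fun k : 'I_M => choice_bit y k) (fun k r s a r' s' a' => @slope_causal _ r s a r' s' a' k) G.
  have -> : Rsum (fun j : vec => G j * \big[Rmult/R1]_(k < M) nu f P (j k))
      = Re (ic_lhs f P m (v - u)%R).
    rewrite (ic_lhsE y); apply: Rsum_ext => j; rewrite /G.
    by case: ifP => _; [exact: Rmult_1_l | exact: Rmult_0_l].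
  set K := / INR p ^ N * / (INR p ^ M * INR p ^ M).
  move=> /(congr1 (Rmult K)) /esym.
  have -> : K * ((INR p ^ 2) ^ M * Re (ic_lhs f P m (v - u)%R))
      = / INR p ^ N * Re (ic_lhs f P m (v - u)%R).
    rewrite /K -pow_mult (_ : Nat.mul 2 M = Nat.add M M); last by lia.
    by rewrite pow_add; field; repeat split; apply: pn || lra.
  move=> ->; rewrite -RsumZ; apply: Rsum_ext => -[r s].
  rewrite -RsumZ; apply: Rsum_ext => a; rewrite -RsumZ; apply: Rsum_ext => b /=.
  rewrite bob_outE xy /G.
  have -> : (v - u + \sum_(t in path_set y) noise (entry x) y r s a b t == 0)%R
      = (u - \sum_(t in path_set y) noise (entry x) y r s a b t == v)%R.
    by rewrite -addrA addr_eq0 opprD opprK eq_sym.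
  by case: ifP => _; rewrite ?Rmult_1_l ?Rmult_0_l ?Rmult_0_r.
have := Rsum_ffun_fiber y u (/ INR p ^ N * Re (ic_lhs f P m (v - u)%R)).
rewrite card_Zmod // => e; apply: (Rmult_eq_reg_l (INR p)); last by lra.
by rewrite e; field; repeat split; apply: pn || lra.
Qed.

Lemma ic_lhs_ge0 c : 0 <= Re (ic_lhs f P m c).
Proof.
rewrite (ic_lhsE 0); apply: Rsum_ge0 => j; case: ifP => _; last exact: Rle_refl.
apply: (big_ind (fun x => 0 <= x)); [lra | exact: Rmult_le_pos |].
by move=> t _; exact: nu_ge0.
Qed.

Lemma ic_lhs_sum1 : Rsum (fun c => Re (ic_lhs f P m c)) = 1.
Proof.
under [LHS]Rsum_ext do rewrite (ic_lhsE 0).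
rewrite /Rsum exchange_big /=.
transitivity (\big[Rplus/R0]_(j : vec) \big[Rmult/R1]_t nu f P (j t)).
  apply: eq_bigr => j _.
  under eq_bigr do rewrite addr_eq0.
  exact: (Rsum_delta (fun=> \big[Rmult/R1]_t nu f P (j t))).
rewrite -(bigA_distr_bigA (fun (_ : 'I_M) j => nu f P j)) big1 // => t _.
exact: nu_sum1.
Qed.

(** All [N] terms of information causality equal the information of one additive noise channel. *)
Lemma pyramid_bound (c : 'Z_p) : (0 < N)%N -> info_causality P ->
  Re (ic_lhs f P m c) <= Tinv p ((INR N - 1) / INR N * log2 (INR p)).
Proof.
move=> N0 ic; have p2 := INR_ge2 p1.
apply: (Tinv_bound c p1 N0 ic_lhs_ge0 ic_lhs_sum1).
rewrite -(mutual_info_shift p1 ic_lhs_ge0 ic_lhs_sum1).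
have ip0 : 0 <= / (INR p ^ M * INR p ^ M).
  by apply/Rlt_le/Rinv_0_lt_compat/Rmult_lt_0_compat; apply: pow_lt; lra.
have pi1 : Rsum (fun _ : vec * vec => / (INR p ^ M * INR p ^ M)) = 1.
  rewrite Rsum_cst card_prod mult_INR card_ffun card_Zmod // card_ord.
  have -> : INR (p ^ M)%N = INR p ^ M.
    by elim: (M) => //= n IHn; rewrite expnS mult_INR IHn.
  have : INR p ^ M <> 0 by apply: pow_nonzero; lra.
  by move=> ?; field.
have := ic N N0 (vec * vec)%type _ M alice_in alice_msg bob_in bob_out
  (fun=> ip0) pi1 alice_causal bob_causal.
rewrite (eq_bigr (fun=> mutual_info
  (fun u v : 'Z_p => / INR p * Re (ic_lhs f P m (v - u)%R)))); last first.
  by move=> y _; apply: mutual_info_ext => u v; exact: joint_law.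
by rewrite Rsum_const card_ord.
Qed.

End Pyramid.

Theorem theorem4 (p : nat) (f : 'Z_p -> 'Z_p -> 'Z_p) (P : box p) :
  prime p -> ~ add_separable f -> Delta_eq f 2 ->
  is_box P -> no_signalling P -> info_causality P ->
  (forall N : nat, leq (S O) N && leq N p -> forall c : 'Z_p,
      Re (ic_lhs f P (subn N (S O)) c)
        <= Tinv p ((INR N - 1) / INR N * log2 (INR p))) /\
  (forall n : nat, leq (S O) n -> forall c : 'Z_p,
      let N := expn p n in
      Re (ic_lhs f P (muln n (subn p (S O))) c)
        <= Tinv p ((INR N - 1) / INR N * log2 (INR p))).
Proof.
move=> pp insep D2 boxP _ ic; have p1 := prime_gt1 pp.
have [lam [g [h fE]]] := Delta2_form p1 D2.
have lam_unit : lam \is a GRing.unit.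
  apply: unit_Zp_prime => //; apply/eqP => lam0; apply: insep.
  by exists g, h => x y; rewrite fE lam0 !mul0r add0r.
split=> [N /andP[N0 _] c | n n0 c N].
  apply: (pyramid_bound p1 boxP lam_unit fE) => //.
  (* [N <= 2 ^ (N - 1)] is [k < 2 ^ k] at [k = N - 1]. *)
  by rewrite -[X in (X <= _)%N](prednK N0) subn1 ltn_expl.
apply: (pyramid_bound p1 boxP lam_unit fE) => //; last by rewrite expn_gt0; lia.
rewrite /N mulnC expnM leq_exp2r //.
by rewrite -[X in (X <= _)%N](prednK (ltnW p1)) subn1 ltn_expl.
Qed.
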